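(* Consider random Chomp: a board consists of cells $(x,y)$ ($x$ = row, $y$ = column, positive integers), and each turn the player to move selects a cell $(x,y)$ of the current board uniformly at random, independently of previous turns, and removes every cell $(p,q)$ with $p\ge x$ and $q\ge y$; the player who selects the cell $(1,1)$ (thereby emptying the board) loses. For integers $0\le k\le n$, let $P(n,k)$ denote the probability that the player who moves first (Player 1) wins starting from the board $\{(1,y):1\le y\le n\}\cup\{(2,y):1\le y\le k\}$ (with $n$ cells in its first row and $k$ in its second), with the convention $P(0,0)=1$. Then for all $n\ge 0$, \[ P(n,0)=\begin{cases}1 & n=0,\\ 0 & n=1,\\ 1/2 & n\ge 2.\end{cases} \] Furthermore, define integer sequences by $\alpha_1=1$, $\beta_1=-1$ and, for $k\ge1$, \[ \alpha_{k+1}=(4k^2+k)\alpha_k+\beta_k,\qquad \beta_{k+1}=-k(k+1)\alpha_k+(4k^2-k-1)\beta_k . \] Then $P(1,1)=1/2$, and for all integers $n\ge k\ge 1$ with $(n,k)\ne(1,1)$, \[ P(n,k)=\frac12-\frac{n\alpha_k+\beta_k}{(2(k-1))!\,(n+k)(n+k-1)(n+k-2)} . \]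
   Context: The convention $P(0,0)=1$ reflects that a player facing the empty board has won, since the previous player selected $(1,1)$. *)

(* Defs.v *)
From HB Require Import structures.
From mathcomp Require Import all_boot all_order all_algebra finmap.
Set Implicit Arguments.
Unset Strict Implicit.
Unset Printing Implicit Defensive.
Import Order.TTheory GRing.Theory Num.Theory.
Local Open Scope fset_scope.
Local Open Scope ring_scope.

(* A cell is a pair (row, column). *)
Definition cell : choiceType := (nat * nat)%type.
Definition board := {fset cell}.

Definition chomp (B : board) (c : cell) : board :=
  [fset d in B | ~~ ((c.1 <= d.1)%N && (c.2 <= d.2)%N)].

(* [is_play B s]: the successive selections [s] are legal from [B] and lead
   to the empty board. *)
Fixpoint is_play (B : board) (s : seq cell) : bool :=
  match s with
  | [::] => B == fset0
  | c :: s' => (c \in B) && is_play (chomp B c) s'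
  end.

(* Each selection is uniform on the current board whatever the past, so the
   probability of a play is the product of the reciprocals of the sizes of the
   boards met along it. *)
Fixpoint play_prob (R : realFieldType) (B : board) (s : seq cell) : R :=
  match s with
  | [::] => 1
  | c :: s' => (#|` B|%:R)^-1 * play_prob R (chomp B c) s'
  end.

(* The probability of the event [E] on the finite space of plays from [B];
   bounding the length of a play by #|` B| loses nothing by [is_play_size], and
   the total mass is 1 by [chomp_prT]. *)
Definition chomp_pr (R : realFieldType) (B : board) (E : pred (seq cell)) : R :=
  \sum_(t : {bseq #|` B| of B} | let s := map val t in is_play B s && E s)
     play_prob R B (map val t).

(* Selections are numbered from 0, so that Player 2 makes the odd-numbered
   ones; the empty play is counted as won by Player 1. *)
Definition player1_wins (s : seq cell) : bool :=
  (s == [::]) || odd (index ((1, 1)%N : cell) s).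

Definition two_row_board (n k : nat) : board :=
  [fset ((1, y)%N : cell) | y in iota 1 n] `|`
  [fset ((2, y)%N : cell) | y in iota 1 k].

Definition win_prob (R : realFieldType) (n k : nat) : R :=
  chomp_pr R (two_row_board n k) player1_wins.

Lemma in_two_row_board n k x y :
  (((x, y) : cell) \in two_row_board n k) =
  ((x == 1) && (1 <= y <= n) || (x == 2) && (1 <= y <= k))%N.
Proof.
rewrite inE; congr (_ || _).
  apply/imfsetP/idP => [[z /= zn [-> ->]]|/andP[/eqP-> yn]].
    by move: zn; rewrite mem_iota add1n ltnS.
  by exists y => //=; rewrite mem_iota add1n ltnS.
apply/imfsetP/idP => [[z /= zn [-> ->]]|/andP[/eqP-> yn]].
  by move: zn; rewrite mem_iota add1n ltnS.
by exists y => //=; rewrite mem_iota add1n ltnS.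
Qed.

Lemma chomp_sub (B : board) (c : cell) : chomp B c `<=` B.
Proof. by apply/fsubsetP => d; rewrite !inE => /andP[]. Qed.

Lemma chomp_card (B : board) (c : cell) :
  c \in B -> (#|` chomp B c| < #|` B|)%N.
Proof.
move=> cB; apply: fproper_ltn_card; rewrite fproperEneq chomp_sub andbT.
by apply/eqP => /fsetP /(_ c); rewrite !inE cB /= !leqnn.
Qed.

Lemma is_play_size (B : board) (s : seq cell) :
  is_play B s -> (size s <= #|` B|)%N.
Proof.
elim: s B => //= c s IH B /andP[cB /IH h].
exact: leq_ltn_trans h (chomp_card cB).
Qed.

Lemma is_play_sub (B : board) (s : seq cell) :
  is_play B s -> {subset s <= B}.
Proof.
elim: s B => //= c s IH B /andP[cB /IH h] d; rewrite inE => /orP[/eqP-> //|].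
by move/h; exact: (fsubsetP (chomp_sub B c)).
Qed.

Lemma is_play_bseq (B : board) (s : seq cell) :
  is_play B s -> exists t : {bseq #|` B| of B}, map val t = s.
Proof.
move=> ps; have [t0 ht0] : exists t0 : seq B, map val t0 = s.
  have := is_play_sub ps; elim: (s) => [|c s' IH] h; first by exists [::].
  case: IH => [d ds|t ht]; first by apply: h; rewrite inE ds orbT.
  have cB : c \in B by apply: h; rewrite mem_head.
  by exists ([` cB] :: t); rewrite /= ht.
have st : (size t0 <= #|` B|)%N.
  by rewrite -(size_map val t0) ht0 is_play_size.
by exists (Bseq st).
Qed.

Lemma chomp_pr_seq (R : realFieldType) (B : board) (E : pred (seq cell))
    (L : seq (seq cell)) :
  uniq L -> (forall s, is_play B s -> s \in L) ->
  chomp_pr R B E = \sum_(s <- L | is_play B s && E s) play_prob R B s.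
Proof.
move=> uL hL; rewrite /chomp_pr /=.
set F := fun t : {bseq #|` B| of B} => map val t : seq cell.
have injF : injective F.
  by move=> s t /(inj_map val_inj) h; apply: val_inj.
rewrite -[LHS]/(\sum_(t | is_play B (F t) && E (F t)) play_prob R B (F t)).
rewrite -(big_map F (fun s => is_play B s && E s) (play_prob R B)).
rewrite -big_filter -[RHS]big_filter; apply: perm_big; apply: uniq_perm.
- by rewrite filter_uniq // map_inj_uniq // index_enum_uniq.
- by rewrite filter_uniq.
move=> s; rewrite !mem_filter; case: (boolP (is_play B s)) => //= ps.
rewrite (hL _ ps) andbT; case: (E s) => //=.
have [t ht] := is_play_bseq ps.
by apply/mapP; exists t; rewrite ?mem_index_enum /F ?ht.
Qed.

Lemma play_list (B : board) :
  {L : seq (seq cell) | uniq L & forall s, is_play B s -> s \in L}.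
Proof.
exists (undup [seq (map val (t : seq B) : seq cell)
              | t : {bseq #|` B| of B}]); first exact: undup_uniq.
move=> s ps; rewrite mem_undup.
have [t ht] := is_play_bseq ps.
by apply/mapP; exists t; rewrite ?mem_enum // ht.
Qed.

Lemma chomp_pr0 (R : realFieldType) (E : pred (seq cell)) :
  chomp_pr R fset0 E = (E [::])%:R.
Proof.
rewrite (@chomp_pr_seq _ _ _ [:: [::]]) //; last by case.
by rewrite big_mkcond big_seq1 /=; case: (E _).
Qed.

Lemma chomp_pr_step (R : realFieldType) (B : board) (E : pred (seq cell)) :
  B != fset0 ->
  chomp_pr R B E =
  (#|` B|%:R)^-1 *
    \sum_(c <- B) chomp_pr R (chomp B c) (fun s => E (c :: s)).
Proof.
move=> B0; pose L c := s2val (play_list (chomp B c)).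
rewrite (@chomp_pr_seq _ _ _ [seq c :: s | c <- B, s <- L c]); first last.
- case=> [|c s] /=; first by rewrite (negPf B0).
  move=> /andP[cB ps]; apply/allpairsPdep; exists c, s; split=> //.
  by rewrite /L; case: play_list => /= l _; apply.
- apply: allpairs_uniq_dep => [|c _|]; first exact: fset_uniq.
    by rewrite /L; case: play_list.
  by move=> [c s] [c' s'] _ _ /= [-> ->].
rewrite big_mkcond big_allpairs_dep mulr_sumr; rewrite !big_seq.
apply: eq_bigr => c cB.
rewrite (@chomp_pr_seq _ _ _ (L c)); first last.
- by rewrite /L; case: play_list.
- by rewrite /L; case: play_list.
rewrite -big_mkcond /= mulr_sumr; apply: eq_bigl => s.
by rewrite cB.
Qed.

Lemma chomp_prT (R : realFieldType) (B : board) : chomp_pr R B predT = 1.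
Proof.
have [m] := ubnP #|` B|; elim: m B => // m IH B; rewrite ltnS => Bm.
have [->|B0] := eqVneq B fset0; first by rewrite chomp_pr0.
rewrite chomp_pr_step // big_seq (eq_bigr (fun=> 1)); last first.
  by move=> c cB; apply: IH; apply: leq_trans (chomp_card cB) Bm.
rewrite -big_seq big_const_seq count_predT iter_addr_0 mulVf //.
by rewrite pnatr_eq0 cardfs_eq0.
Qed.

(* Main.v *)
(* Conditioning on the first selection, the bias Q(n,k) = P(n,k) - 1/2 satisfies
   (n+k) Q(n,k) + sum_(y<k) Q(n,y) + sum_(y<n) Q(y, min(k,y)) = 0.  Taking a mixed
   difference in n and k removes both sums:
     (n+k+2) Q(n+1,k+1) = (n+k) (Q(n,k+1) + Q(n+1,k)) - (n+k-2) Q(n,k)   (k < n),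
   while comparing the boards (k+1,k+1) and (k+1,k) gives the boundary relation
     (2k+2) Q(k+1,k+1) = 2k Q(k+1,k).
   Together with Q(n,0) these determine Q, and the recurrences of alpha and beta
   are exactly what makes the closed formula satisfy them. *)
Require Import Defs.
From HB Require Import structures.
From mathcomp Require Import all_boot all_order all_algebra finmap.
From mathcomp Require Import zify ring lra.
Set Implicit Arguments.
Unset Strict Implicit.
Unset Printing Implicit Defensive.
Import Order.TTheory GRing.Theory Num.Theory.
Local Open Scope ring_scope.

(** * Events on plays and the exchange of the players *)

Lemma eq_chomp_pr (R : realFieldType) (B : board) (E E' : pred (seq cell)) :
  (forall s, is_play B s -> E s = E' s) -> chomp_pr R B E = chomp_pr R B E'.
Proof.
move=> EE'; have [L uL hL] := play_list B.
rewrite !(chomp_pr_seq _ _ uL hL); apply: eq_bigl => s.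
by case: (boolP (is_play B s)) => // /EE' ->.
Qed.

Lemma chomp_prC (R : realFieldType) (B : board) (E : pred (seq cell)) :
  chomp_pr R B (predC E) = 1 - chomp_pr R B E.
Proof.
have [L uL hL] := play_list B; rewrite -(chomp_prT R B).
rewrite !(chomp_pr_seq _ _ uL hL) /=; apply/esym/eqP; rewrite subr_eq addrC.
rewrite (bigID E) /=; apply/eqP; congr (_ + _);
  by apply: eq_bigl => s; rewrite andbT.
Qed.

Lemma in_chomp (B : board) (c d : cell) :
  (d \in chomp B c) = (d \in B) && ~~ ((c.1 <= d.1)%N && (c.2 <= d.2)%N).
Proof. by rewrite !inE. Qed.

(** The position of [(1, 1)] in the play shifts by one, so its parity flips. If [c] is [(1, 1)]
    itself, positivity of the coordinates makes the board empty, and the convention on the empty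
    play gives the same exchange. *)
Lemma player1_wins_cons (B : board) (c : cell) (s : seq cell) :
  ((1, 1)%N : cell) \in B -> (forall d, d \in B -> 0 < d.1 /\ 0 < d.2)%N ->
  c \in B -> is_play (chomp B c) s ->
  player1_wins (c :: s) = ~~ player1_wins s.
Proof.
move=> B11 Bpos cB ps; rewrite /player1_wins /=.
have [c11|cN] := eqVneq c ((1, 1)%N : cell).
  suff -> : s = [::] by [].
  case: s ps => [//|d s] /= /andP[]; rewrite c11 !inE => /andP[/Bpos[d1 d2]].
  by rewrite d1 d2.
case: s ps => [|d s] //= /eqP/fsetP/(_ ((1, 1)%N : cell)).
rewrite !inE B11 /= => /negbFE/andP[c1 c2]; case/eqP: cN.
have [p1 p2] := Bpos _ cB; case: c c1 c2 p1 p2 {cB} => a b /= ? ? ? ?; congr pair; lia.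
Qed.

(** * Moves on two-row boards *)

Lemma mem11_two_row_board n k :
  (0 < n)%N -> ((1, 1)%N : cell) \in two_row_board n k.
Proof. by move=> n0; rewrite in_two_row_board n0. Qed.

Lemma two_row_board_perm n k :
  perm_eq (enum_fset (two_row_board n k))
    ([seq (1, y)%N | y <- iota 1 n] ++ [seq (2, y)%N | y <- iota 1 k]).
Proof.
apply: uniq_perm; first exact: fset_uniq.
  rewrite cat_uniq !map_inj_uniq ?iota_uniq ?andbT //=; try by move=> ? ? [].
  by apply/hasPn => _ /mapP[y _ ->]; apply/mapP => -[].
by move=> c; rewrite mem_cat !inE; congr orb; apply/imfsetP/mapP;
  case=> y yi ->; exists y.
Qed.

Lemma chomp_two_row_board1 n k y :
  (y < n)%N -> chomp (two_row_board n k) (1, y.+1)%N = two_row_board y (minn k y).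
Proof.
move=> yn; apply/fsetP => -[a b]; rewrite in_chomp !in_two_row_board /=; lia.
Qed.

Lemma chomp_two_row_board2 n k y :
  (y < k)%N -> chomp (two_row_board n k) (2, y.+1)%N = two_row_board n y.
Proof.
move=> yn; apply/fsetP => -[a b]; rewrite in_chomp !in_two_row_board /=; lia.
Qed.

(** The index [y] counts the cells left in the row of the selection. The terms are complements
    because the opponent moves next. *)
Lemma win_prob_step (R : realFieldType) n k : (0 < n)%N ->
  (n + k)%:R * win_prob R n k =
  \sum_(0 <= y < n) (1 - win_prob R y (minn k y)) +
  \sum_(0 <= y < k) (1 - win_prob R n y).
Proof.
move=> n0; have B11 := mem11_two_row_board k n0.
have Bperm := two_row_board_perm n k.
have Bcard : #|` two_row_board n k| = (n + k)%N.
  by rewrite (perm_size Bperm) size_cat !size_map !size_iota.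
rewrite /win_prob chomp_pr_step; last by apply/fset0Pn; exists (1, 1)%N.
rewrite Bcard mulrA divff ?mul1r; last by rewrite pnatr_eq0; lia.
rewrite big_seq.
under eq_bigr => c cB.
  rewrite (@eq_chomp_pr _ _ _ (predC player1_wins)); last first.
    move=> s; apply: (player1_wins_cons B11) => // -[a b].
    by rewrite in_two_row_board /=; lia.
  rewrite chomp_prC; over.
rewrite -big_seq (perm_big _ Bperm) /= big_cat /= !big_map.
rewrite -[1%N]addn0 !iotaDl !big_map /=; congr (_ + _).
  rewrite big_seq [RHS]big_seq /index_iota subn0; apply: eq_bigr => y.
  by rewrite mem_iota => yn; rewrite chomp_two_row_board1 //; lia.
rewrite big_seq [RHS]big_seq /index_iota subn0; apply: eq_bigr => y.
by rewrite mem_iota => yn; rewrite chomp_two_row_board2 //; lia.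
Qed.

(** * The bias and its recurrences *)

(** Centring at 1/2 cancels the constants, so the first-move equation becomes homogeneous. *)
Definition win_bias (R : realFieldType) n k : R := win_prob R n k - 1 / 2.

Lemma win_bias_step (R : realFieldType) n k : (0 < n)%N ->
  (n + k)%:R * win_bias R n k + \sum_(0 <= y < n) win_bias R y (minn k y)
    + \sum_(0 <= y < k) win_bias R n y = 0.
Proof.
move=> /(win_prob_step R k); rewrite /win_bias !sumrB !sumr_const_nat !subn0.
rewrite mulrBr => ->; rewrite natrD.
by field.
Qed.

Lemma win_bias00 (R : realFieldType) : win_bias R 0 0 = 1 / 2.
Proof.
rewrite /win_bias /win_prob (_ : two_row_board 0 0 = fset0); last first.
  by apply/fsetP => -[a b]; rewrite in_two_row_board inE; lia.
by rewrite chomp_pr0 /=; field.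
Qed.

Lemma win_bias10 (R : realFieldType) : win_bias R 1 0 = - (1 / 2).
Proof.
have := win_bias_step R 0 (ltn0Sn 0).
by rewrite big_nat1 big_nil minn0 win_bias00; lra.
Qed.

(** The biases 1/2 and -1/2 at lengths 0 and 1 cancel, so the sum over shorter rows stays zero and
    forces each later bias to vanish. *)
Lemma win_bias_n0 (R : realFieldType) n : win_bias R n.+2 0 = 0.
Proof.
have step m := win_bias_step R 0 (ltn0Sn m).
suff sum0 m : \sum_(0 <= y < m.+2) win_bias R y (minn 0 y) = 0.
  have /eqP := step n.+1; rewrite sum0 big_nil !addr0 mulf_eq0 pnatr_eq0.
  by move=> /eqP.
elim: m => [|m IH].
  by rewrite big_nat_recr //= big_nat1 !min0n win_bias00 win_bias10; field.
rewrite big_nat_recr // IH min0n; have /eqP := step m.+1.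
rewrite IH big_nil !addr0 mulf_eq0 pnatr_eq0 /= => /eqP ->.
by rewrite addr0.
Qed.

(* Both boards of the equation have the same first-row moves, as a first-row
   move from a (k+1)-cell row never leaves more than k columns. *)
Lemma win_bias_diag (R : realFieldType) k :
  (2 * k%:R + 2) * win_bias R k.+1 k.+1 = 2 * k%:R * win_bias R k.+1 k.
Proof.
have := win_bias_step R k.+1 (ltn0Sn k); have := win_bias_step R k (ltn0Sn k).
rewrite (@eq_big_nat _ _ _ 0 k.+1 _ (fun y => win_bias R y y)); last first.
  by move=> y yk; rewrite (minn_idPr _) //; lia.
rewrite (@eq_big_nat _ _ _ 0 k.+1 (fun y => win_bias R y (minn k.+1 y))
  (fun y => win_bias R y y)); last first.
  by move=> y yk; rewrite (minn_idPr _) //; lia.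
(* The one extra second-row move leads to the board (k+1,k) and lowers its coefficient from 2k+1 to
   2k. *)
rewrite [\sum_(0 <= y < k.+1) win_bias R k.+1 y]big_nat_recr //=.
rewrite !natrD -!natr1; lra.
Qed.

(** Passing from n to n+1 adds a single first-row term, Q(n, min(k,n)) = Q(n,k). *)
Lemma win_bias_diff_row (R : realFieldType) n k : (k <= n)%N -> (0 < n)%N ->
  (n%:R + 1 + k%:R) * win_bias R n.+1 k - (n%:R + k%:R - 1) * win_bias R n k =
  - \sum_(0 <= y < k) (win_bias R n.+1 y - win_bias R n y).
Proof.
move=> kn n0; have := win_bias_step R k (ltn0Sn n).
have := win_bias_step R k n0; rewrite big_nat_recr //= (minn_idPl kn).
rewrite [X in _ = - X]sumrB !natrD -(@natr1 _ n); lra.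
Qed.

Lemma win_bias_mixed_diff (R : realFieldType) n k : (k < n)%N ->
  (n%:R + k%:R + 2) * win_bias R n.+1 k.+1 =
  (n%:R + k%:R) * (win_bias R n k.+1 + win_bias R n.+1 k)
    - (n%:R + k%:R - 2) * win_bias R n k.
Proof.
move=> kn; have n0 : (0 < n)%N by lia.
have := win_bias_diff_row R (ltnW kn) n0; have := win_bias_diff_row R kn n0.
rewrite big_nat_recr //= -(@natr1 _ k); lra.
Qed.

(** * The closed formula *)

Definition bias_formula (R : realFieldType) (a b : int) n k : R :=
  - ((n%:R * a%:~R + b%:~R) /
     (((2 * (k - 1))`!)%:R * (n%:R + k%:R) * (n%:R + k%:R - 1)
        * (n%:R + k%:R - 2))).

(* At [n = 0] the formula reads [0 / 0 = 0], which is the right value. *)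
Lemma win_bias_col1 (R : realFieldType) n :
  win_bias R n.+1 1 = bias_formula R 1 (-1) n.+1 1.
Proof.
have Wn (m : nat) : 0 <= m%:R :> R by exact: ler0n.
have W11 : win_bias R 1 1 = 0.
  have := win_bias_diag R 0; rewrite mulr0 mul0r => /eqP.
  by rewrite mulf_eq0 add0r pnatr_eq0 => /eqP.
rewrite /bias_formula fact0 rmorphN1 rmorph1.
case: n => [|n]; first by rewrite W11 mulr1 subrr mul0r oppr0.
elim: n => [|n IH].
  (* Here Q(1,0) = -1/2 enters and gives Q(2,1) = -1/6; for longer rows the biases Q(n,0) vanish. *)
  have := @win_bias_mixed_diff R 1 0 (ltn0Sn 0).
  rewrite W11 win_bias_n0 win_bias10 => h.
  by rewrite [LHS](_ : _ = - (1 / 6)); [field | lra].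
have := @win_bias_mixed_diff R n.+2 0 (ltn0Sn _).
rewrite IH !win_bias_n0 => h.
have n4 : n.+2%:R + 0 + 2 != 0 :> R by apply: lt0r_neq0; rewrite -!natr1; have := Wn n; lra.
apply: (mulfI n4); rewrite h -!natr1; field.
by have ? := Wn n; do ?[apply/andP; split]; apply: lt0r_neq0; lra.
Qed.

(** Induction on k, then on n - k: the boundary relation starts each k on the diagonal, and the
    mixed difference lengthens the first row. *)
Lemma win_bias_formula (R : realFieldType) (alpha beta : nat -> int) :
  alpha 1%N = 1 -> beta 1%N = -1 ->
  (forall k : nat, (1 <= k)%N ->
     alpha k.+1 = (4 * k%:Z ^+ 2 + k%:Z) * alpha k + beta k) ->
  (forall k : nat, (1 <= k)%N ->
     beta k.+1 = - (k%:Z * (k%:Z + 1)) * alpha k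
                 + (4 * k%:Z ^+ 2 - k%:Z - 1) * beta k) ->
  forall k n : nat, (k <= n)%N ->
    win_bias R n.+1 k.+1 = bias_formula R (alpha k.+1) (beta k.+1) n.+1 k.+1.
Proof.
move=> a1 b1 aS bS; elim=> [|k IHk].
  by rewrite a1 b1 => n _; apply: win_bias_col1.
have k0 : 0 <= k%:R :> R by exact: ler0n.
have fact_n0 : ((2 * (k.+1 - 1))`!)%:R != 0 :> R.
  by rewrite pnatr_eq0 -lt0n fact_gt0.
have fact_SS : ((2 * (k.+2 - 1))`!)%:R =
    (2 * k%:R + 2) * ((2 * k%:R + 1) * ((2 * (k.+1 - 1))`!)%:R) :> R.
  rewrite !subn1 /= mulnS add2n !factS !natrM -!natr1 natrM; ring.
have aS' : (alpha k.+2)%:~R = (4 * (k%:R + 1) ^+ 2 + (k%:R + 1)) * (alpha k.+1)%:~R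
    + (beta k.+1)%:~R :> R.
  rewrite aS // !(rmorphD, rmorphM, rmorphXn) /= -!natr1; ring.
have bS' : (beta k.+2)%:~R = - ((k%:R + 1) * (k%:R + 2)) * (alpha k.+1)%:~R
    + (4 * (k%:R + 1) ^+ 2 - (k%:R + 1) - 1) * (beta k.+1)%:~R :> R.
  rewrite bS // !(rmorphD, rmorphM, rmorphXn, rmorphN) /= -!natr1; ring.
move=> n /subnK <-; elim: (n - _)%N => [|m IHm].
  have := win_bias_diag R k.+1; rewrite IHk //= add0n => h.
  have d0 : 2 * k.+1%:R + 2 != 0 :> R by apply: lt0r_neq0; rewrite -!natr1; lra.
  apply: (mulfI d0); rewrite h /bias_formula fact_SS aS' bS' -!natr1; field.
  by rewrite fact_n0 /=; do ?[apply/andP; split]; apply: lt0r_neq0; lra.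
have m0 : 0 <= m%:R :> R by exact: ler0n.
(* All boards met here have n + k > 2, so no denominator vanishes. *)
have := @win_bias_mixed_diff R (m + k.+1).+1 k.+1 (ltac:(lia)).
rewrite IHm IHk; last by lia.
rewrite (IHk (m + k.+1)%N) ?addSn => [h|]; last by lia.
have d0 : (m + k.+1).+1%:R + k.+1%:R + 2 != 0 :> R.
  by apply: lt0r_neq0; rewrite -!natr1 natrD -!natr1; lra.
apply: (mulfI d0); rewrite h /bias_formula fact_SS aS' bS' -!natr1 natrD -!natr1.
field.
by rewrite fact_n0 /=; do ?[apply/andP; split]; apply: lt0r_neq0; lra.
Qed.

Theorem theorem3 (R : realFieldType) :
  (forall n : nat,
     win_prob R n 0 = if n == 0%N then 1 else if n == 1%N then 0 else 1 / 2) /\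
  (forall alpha beta : nat -> int,
     alpha 1%N = 1 -> beta 1%N = -1 ->
     (forall k : nat, (1 <= k)%N ->
        alpha k.+1 = (4 * k%:Z ^+ 2 + k%:Z) * alpha k + beta k) ->
     (forall k : nat, (1 <= k)%N ->
        beta k.+1 = - (k%:Z * (k%:Z + 1)) * alpha k
                    + (4 * k%:Z ^+ 2 - k%:Z - 1) * beta k) ->
     win_prob R 1 1 = 1 / 2 /\
     forall n k : nat, (1 <= k)%N -> (k <= n)%N -> (n, k) <> (1%N, 1%N) ->
       win_prob R n k = 1 / 2 -
         (n%:R * (alpha k)%:~R + (beta k)%:~R) /
         (((2 * (k - 1))`!)%:R * (n%:R + k%:R) * (n%:R + k%:R - 1)
            * (n%:R + k%:R - 2))).
Proof.
split=> [n|alpha beta a1 b1 aS bS].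
  have -> : win_prob R n 0 = win_bias R n 0 + 1 / 2 by rewrite /win_bias subrK.
  case: n => [|[|n]]; rewrite ?win_bias00 ?win_bias10 ?win_bias_n0 /=; lra.
have main n k : (1 <= k)%N -> (k <= n)%N ->
    win_prob R n k = 1 / 2 + bias_formula R (alpha k) (beta k) n k.
  case: k n => // k [//|n] _ kn.
  by rewrite -(win_bias_formula R a1 b1 aS bS) // /win_bias addrC subrK.
split=> [|n k k1 kn _]; last exact: main.
(* At (1,1) the numerator is 1 - 1 = 0, so the formula yields 1/2 there too. *)
rewrite main // /bias_formula a1 b1 rmorphN1 rmorph1 mulr1 subrr mul0r oppr0.
by rewrite addr0.
Qed.
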